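(* Let $(G,X,x_0)$ be a $0$-dimensional ambit, $\mathcal{B}$ the Boolean algebra of clopen subsets of $X$, and $S\subseteq X$. The following conditions are equivalent: (1) The $G$-ambit $X$ has sep. fin. $S$-DRdeg. (2) For every finite subset $\Delta$ of $G\backslash\mathcal{B}$ there exists $\eta\in E(S_\Delta(X))$ such that $\eta[S_\Delta(S)]$ is finite.
   Context: Compact spaces are Hausdorff. A flow $(G,X)$ is a topological group $G$ acting continuously on a compact space $X$. An ambit $(G,X,x_0)$ is a flow with a distinguished point $x_0\in X$ whose orbit is dense; it is $0$-dimensional if $X$ has a basis of clopen sets. The Ellis semigroup $E(Y)$ of a flow $(G,Y)$ is the closure in $Y^Y$ (product topology) of the set of maps $y\mapsto gy$, $g\in G$, with composition. A coloring is a function $c\colon G\to 2^n$, $n\ge 1$. For $S\subseteq X$ and $\Sigma\subseteq\mathcal{B}$, $c$ is an $S$-definable $\Sigma$-coloring if there are $U_0,\dots,U_{n-1}\in\Sigma$ and $y_0,\dots,y_{n-1}\in S$ such that for all $g\in G$, $i<n$: $c(g)(i)=1$ if $y_i\in gU_i$ and $c(g)(i)=0$ if $y_i\notin gU_i$. The ambit has separately finite $S$-definable Ramsey degree (sep. fin. $S$-DRdeg) if for every finite $\Sigma\subseteq\mathcal{B}$ there is $l=l(S,\Sigma)\ge 1$ such that for every $S$-definable $\Sigma$-coloring $c\colon G\to 2^n$ (any $n\geq 1$), every $k\ge 1$ and every $k$-element $A\subseteq G$, there is $h\in G$ with $|c[hA]|\le l$. $G\backslash\mathcal{B}$ is the set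 of all $G$-orbits $GU=\{gU:g\in G\}$, $U\in\mathcal{B}$. For $\Delta\subseteq G\backslash\mathcal{B}$, $\mathcal{A}(\Delta)$ is the Boolean $G$-algebra (Boolean algebra closed under the $G$-action) of subsets of $X$ generated by $\bigcup\Delta$, and $S_\Delta(X)$ is the Stone space of $\mathcal{A}(\Delta)$ with the natural left $G$-action (a $G$-flow). The map $\pi_\Delta\colon X\to S_\Delta(X)$, $\pi_\Delta(x)=\{U\in\mathcal{A}(\Delta): x\in U\}$, is a $G$-flow epimorphism, and $S_\Delta(S):=\pi_\Delta[S]$. *)

(* Defs.v *)
From HB Require Import structures.
From mathcomp Require Import all_boot all_order all_algebra.
From mathcomp Require Import all_classical all_reals all_analysis.

Set Implicit Arguments.
Unset Strict Implicit.
Unset Printing Implicit Defensive.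

Local Open Scope classical_set_scope.

HB.mixin Record isTopologicalGroup G of Topological G & Group G := {
  mulg_continuous : continuous (fun x : G * G => (x.1 * x.2)%g);
  invg_continuous : continuous (fun x : G => (x^-1)%g)
}.

#[short(type="topGroupType")]
HB.structure Definition TopologicalGroup :=
  {G of Topological G & Group G & isTopologicalGroup G}.

HB.mixin Record isFlow (G : topGroupType) X of Topological X := {
  act : G -> X -> X;
  act1 : forall x, act 1%g x = x;
  actM : forall g h x, act (g * h)%g x = act g (act h x);
  act_continuous : continuous (fun z : G * X => act z.1 z.2);
  flow_compact : compact [set: X];
  flow_hausdorff : hausdorff_space X
}.

#[short(type="flowType")]
HB.structure Definition Flow (G : topGroupType) :=
  {X of Topological X & isFlow G X}.

Section flow.
Context {G : topGroupType}.

Definition ambit (X : flowType G) (x0 : X) :=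
  dense [set act g x0 | g in [set: G]].

Definition ellis (Y : flowType G) : set {ptws Y -> Y} :=
  closure [set (act g : {ptws Y -> Y}) | g in [set: G]].

End flow.
Arguments ellis {G} Y.

(* Stated through a basis; MathComp-Analysis's [zero_dimensional] says instead
   that clopen sets separate points. *)
Definition has_clopen_basis (X : topologicalType) :=
  exists2 B : set (set X), B `<=` clopen & basis B.

Section ramsey_degree.
Context {G : topGroupType} {X : flowType G}.

Definition definable_coloring (S : set X) (Sigma : set (set X)) (n : nat)
    (c : G -> {ffun 'I_n -> bool}) :=
  exists U : 'I_n -> set X, exists y : 'I_n -> X,
    [/\ forall i, Sigma (U i), forall i, S (y i) &
        forall g i, c g i = (y i \in act g @` U i)].

Definition sep_fin_DRdeg (S : set X) :=
  forall Sigma : set (set X), finite_set Sigma -> Sigma `<=` clopen ->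
  exists2 l : nat, (1 <= l)%N &
    forall (n : nat) (c : G -> {ffun 'I_n -> bool}),
      (1 <= n)%N -> definable_coloring S Sigma c ->
    forall (k : nat) (A : set G), (1 <= k)%N -> (A #= `I_k)%card ->
    exists h : G, (c @` [set (h * a)%g | a in A] #<= `I_l)%card.

End ramsey_degree.

Section stone_flow.
Context {G : topGroupType} (X : flowType G).
Implicit Types (U V : set X) (g h : G).

Definition translates U : set (set X) := [set act g @` U | g in [set: G]].

(* G\B; used as a type through the coercion [set_type], so that a
   [Delta : set clopen_orbits] is a set of orbits of clopen sets. *)
Definition clopen_orbits : set (set (set X)) := [set translates U | U in clopen].

Definition boolean_Galgebra (A : set (set X)) :=
  [/\ A setT, setI_closed A, setC_closed A &
      forall g U, A U -> A (act g @` U)].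

Definition generated_Galgebra (Delta : set clopen_orbits) : set (set X) :=
  smallest boolean_Galgebra (\bigcup_(O in Delta) set_val O).

Definition ultrafilter_in (A p : set (set X)) :=
  [/\ p `<=` A, p setT /\ ~ p set0,
      forall U V, p U -> p V -> p (U `&` V),
      forall U V, p U -> A V -> U `<=` V -> p V &
      forall U, A U -> p U \/ p (~` U)].

Record stone_space (Delta : set clopen_orbits) := StoneSpace {
  stone_val : set (set X);
  stone_valP : ultrafilter_in (generated_Galgebra Delta) stone_val
}.

Lemma act_inv g : cancel (act g : X -> X) (act g^-1%g).
Proof. by move=> x; rewrite -actM mulVg act1. Qed.

Lemma act_invV g : cancel (act g^-1%g : X -> X) (act g).
Proof. by move=> x; rewrite -actM mulgV act1. Qed.

Lemma image_act g U : act g @` U = act g^-1%g @^-1` U.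
Proof.
apply/seteqP; split=> [_ [x Ux <-]|x Ux] /=; first by rewrite act_inv.
by exists (act g^-1%g x) => //; rewrite act_invV.
Qed.

Lemma generated_GalgebraP Delta : boolean_Galgebra (generated_Galgebra Delta).
Proof.
split.
- by move=> A [[]].
- move=> U V AU AV A HA; have [[_ AI _ _] _] := HA.
  by apply: AI; [exact: AU|exact: AV].
- move=> U AU A HA; have [[_ _ AC _] _] := HA.
  by apply: AC; exact: AU.
- move=> g U AU A HA; have [[_ _ _ AG] _] := HA.
  by apply: AG; exact: AU.
Qed.

Lemma act_slice_continuous g : continuous (act g : X -> X).
Proof.
move=> x.
apply: (@continuous_comp _ _ _ (pair g) (fun z : G * X => act z.1 z.2)).
  by apply: cvg_pair; [exact: cvg_cst|exact: cvg_id].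
exact: act_continuous.
Qed.

Lemma clopen_Galgebra : boolean_Galgebra clopen.
Proof.
split.
- exact: clopenT.
- by move=> U V; exact: clopenI.
- by move=> U; exact: clopenC.
- move=> g U cU; rewrite image_act; apply: preimage_clopen => //.
  exact: act_slice_continuous.
Qed.

Lemma generated_Galgebra_clopen Delta : generated_Galgebra Delta `<=` clopen.
Proof.
apply: smallest_sub; first exact: clopen_Galgebra.
move=> U [W _ WU]; have := set_valP W => -[V cV VW].
have [g _ <-] : translates V U by rewrite VW.
by have [_ _ _] := clopen_Galgebra; apply.
Qed.

Lemma pi_subproof Delta (x : X) :
  ultrafilter_in (generated_Galgebra Delta)
    [set U | generated_Galgebra Delta U /\ U x].
Proof.
have [AT AI AC AG] := generated_GalgebraP Delta; split => //.
- by move=> U [].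
- by split; [split|case].
- by move=> U V [AU Ux] [AV Vx]; split=> //; exact: AI.
- by move=> U V [AU Ux] AV UV; split=> //; exact: UV.
- by move=> U AU; have [Ux|Ux] := lem (U x); [left|right; split=> //; exact: AC].
Qed.

Definition stone_pi Delta (x : X) : stone_space Delta :=
  StoneSpace (pi_subproof Delta x).

Lemma stone_act_subproof Delta g (p : stone_space Delta) :
  ultrafilter_in (generated_Galgebra Delta) [set act g @` U | U in stone_val p].
Proof.
have [AT AI AC AG] := generated_GalgebraP Delta.
have [pA [pT p0] pI pS pU] := stone_valP p.
split => //.
- by move=> _ [U pU' <-]; apply: AG; exact: pA.
- split; first by exists setT => //; rewrite image_act preimage_setT.
  by move=> [U pU' /image_set0_set0 U0]; apply: p0; rewrite -U0.
- move=> _ _ [U pU' <-] [V pV <-]; exists (U `&` V); first exact: pI.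
  by rewrite !image_act preimage_setI.
- move=> _ V [U pU' <-] AV UV; exists (act g^-1%g @` V).
    by apply: (pS _ _ pU' (AG _ _ AV)) => x Ux; exists (act g x);
      [apply: UV; exists x|rewrite act_inv].
  by rewrite !image_act invgK -comp_preimage; apply/seteqP; split=> x /=;
    rewrite act_invV.
- move=> U AU; have [pU'|pU'] := pU _ (AG g^-1%g _ AU); [left|right].
    exists (act g^-1%g @` U) => //.
    by rewrite !image_act invgK; apply/seteqP; split=> x /=; rewrite act_invV.
  exists (~` (act g^-1%g @` U)) => //.
  by rewrite !image_act invgK; apply/seteqP; split=> x /=; rewrite act_invV.
Qed.

Definition stone_act Delta g (p : stone_space Delta) : stone_space Delta :=
  StoneSpace (stone_act_subproof g p).

HB.instance Definition _ Delta := gen_eqMixin (stone_space Delta).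
HB.instance Definition _ Delta := gen_choiceMixin (stone_space Delta).

Definition stone_basic Delta U : set (stone_space Delta) :=
  [set p | stone_val p U].
Arguments stone_basic : clear implicits.

Lemma stone_basic_cover Delta :
  \bigcup_(U in generated_Galgebra Delta) stone_basic Delta U = setT.
Proof.
apply/seteqP; split=> // p _; have [AT _ _ _] := generated_GalgebraP Delta.
by exists setT => //; have [_ []] := stone_valP p.
Qed.

Lemma stone_basic_join Delta U V (p : stone_space Delta) :
  generated_Galgebra Delta U -> generated_Galgebra Delta V ->
  stone_basic Delta U p -> stone_basic Delta V p ->
  exists W, [/\ generated_Galgebra Delta W, stone_basic Delta W p &
    stone_basic Delta W `<=` stone_basic Delta U `&` stone_basic Delta V].
Proof.
have [_ AI _ _] := generated_GalgebraP Delta.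
move=> AU AV pU pV; exists (U `&` V); split; first exact: AI.
  by have [_ _ pI _ _] := stone_valP p; exact: pI.
move=> q qUV; have [_ _ _ qS _] := stone_valP q.
by split; apply: (qS _ _ qUV) => // x [].
Qed.

HB.instance Definition _ Delta := @isBaseTopological.Build (stone_space Delta)
  (set X) (generated_Galgebra Delta) (stone_basic Delta)
  (stone_basic_cover Delta) (@stone_basic_join Delta).

Lemma stone_basic_open Delta U :
  generated_Galgebra Delta U -> open (stone_basic Delta U).
Proof.
move=> AU; exists [set U]; first by move=> _ ->.
by rewrite bigcup_set1.
Qed.

Lemma stone_nbhsP Delta (p : stone_space Delta) (N : set (stone_space Delta)) :
  nbhs p N <-> exists U, stone_val p U /\ stone_basic Delta U `<=` N.
Proof.
rewrite nbhsE; split=> [[W [[D DA <-] [U DU pU]] WN]|[U [pU UN]]].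
  by exists U; split=> // q qU; apply: WN; exists U.
exists (stone_basic Delta U) => //; split=> //; apply: stone_basic_open.
by have [pA _ _ _ _] := stone_valP p; exact: pA.
Qed.

Lemma stone_eqP Delta (p q : stone_space Delta) :
  stone_val p `<=` stone_val q -> p = q.
Proof.
case: p q => [p pP] [q qP] /= pq; suff e : p = q.
  by case: _ / e in qP pq *; congr StoneSpace; exact: Prop_irrelevance.
apply/seteqP; split=> // U qU.
have [_ _ _ _ pU] := pP; have [qA [_ q0] qI _ _] := qP.
have [//|/pq qCU] := pU U (qA _ qU).
by case: q0; have := qI _ _ qU qCU; rewrite setICr.
Qed.

Lemma stone_act1 Delta (p : stone_space Delta) : stone_act 1%g p = p.
Proof.
apply: stone_eqP => _ [U pU <-].
suff -> : act 1%g @` U = U by [].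
by rewrite image_act invg1; apply/seteqP; split=> x /=; rewrite act1.
Qed.

Lemma stone_actM Delta g h (p : stone_space Delta) :
  stone_act (g * h)%g p = stone_act g (stone_act h p).
Proof.
apply: stone_eqP => _ [U pU <-].
exists (act h @` U); first by exists U.
rewrite image_comp; apply/seteqP.
by split=> _ [x Ux <-]; exists x => //=; rewrite actM.
Qed.

Lemma stone_compact Delta : compact [set: stone_space Delta].
Proof.
rewrite compact_ultra => F FU _.
have [AT AI AC AG] := generated_GalgebraP Delta.
have uF : ultrafilter_in (generated_Galgebra Delta)
    [set U | generated_Galgebra Delta U /\ F (stone_basic Delta U)].
  split.
  - by move=> U [].
  - split; first split=> //.
      by apply: filterS filterT => p _; have [_ []] := stone_valP p.
    move=> [_ F0]; have [p] := filter_ex F0.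
    by have [_ []] := stone_valP p.
  - move=> U V [AU FU'] [AV FV]; split; first exact: AI.
    apply: filterS (filterI FU' FV) => p [pU pV].
    by have [_ _ pI _ _] := stone_valP p; exact: pI.
  - move=> U V [AU FU'] AV UV; split=> //; apply: filterS FU' => p pU.
    by have [_ _ _ pS _] := stone_valP p; exact: (pS _ _ pU).
  - move=> U AU.
    have [FU'|FU'] := in_ultra_setVsetC (stone_basic Delta U) FU; [by left|right].
    split; first exact: AC.
    apply: filterS FU' => p npU; have [_ _ _ _ pU] := stone_valP p.
    by have [|] := pU _ AU.
exists (StoneSpace uF); split=> // N /stone_nbhsP[U [[AU FU'] UN]].
exact: filterS FU'.
Qed.

Lemma stone_hausdorff Delta : hausdorff_space (stone_space Delta).
Proof.
move=> p q pq; apply: stone_eqP => U pU.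
have [pA _ _ _ _] := stone_valP p; have [_ _ _ _ qU] := stone_valP q.
have [//|qCU] := qU _ (pA _ pU).
have [r [rU rCU]] : stone_basic Delta U `&` stone_basic Delta (~` U) !=set0.
  apply: pq; apply/stone_nbhsP; first by exists U; split.
  by exists (~` U); split.
have [_ [_ r0] rI _ _] := stone_valP r.
by case: r0; have := rI _ _ rU rCU; rewrite setICr.
Qed.

Lemma near_image_act g U : clopen U ->
  \forall h \near g, act h^-1%g @` U = act g^-1%g @` U.
Proof.
move=> cU.
pose P h x := U (act h x) <-> U (act g x).
have near_clopen V (z : G * X) : clopen V -> V (act z.1 z.2) ->
    \forall w \near z, V (act w.1 w.2).
  move=> [oV _] Vz; apply: (@act_continuous G X z).
  exact: open_nbhs_nbhs.
have : \forall h \near g, [set: X] `<=` P h.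
  have /compact_near_coveringP cX := @flow_compact G X.
  apply: cX => x _.
  suff near_P V : clopen V -> V (act g x) ->
      \forall x' \near x & h \near g, V (act h x') /\ V (act g x').
    have [Ux|Ux] := lem (U (act g x)).
      by have := near_P U cU Ux; apply: filterS => -[x' h] [/= h1 h2]; split.
    have [MN /= MNxg MNU] := near_P (~` U) (clopenC U cU) Ux.
    by exists MN => // z /MNU[/= h1 h2]; split.
  move=> cV Vx.
  have [[N M] /= [Ng Mx] NM] := near_clopen V (g, x) cV Vx.
  exists (M, N) => //= -[x' h] [/= Mx' Nh]; split; first exact: (NM (h, x')).
  by apply: (NM (g, x')); split=> //=; exact: nbhs_singleton.
apply: filterS => h hP; rewrite !image_act !invgK.
by apply/seteqP; split=> x /=; apply (hP x I).
Qed.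

Lemma stone_act_continuous Delta :
  continuous (fun z : G * stone_space Delta => stone_act z.1 z.2).
Proof.
move=> [g p] N /stone_nbhsP[_ [[/= U pU <-]] UN].
have [pA _ _ _ _] := stone_valP p.
have [_ _ _ AG] := generated_GalgebraP Delta.
have AgU := AG g _ (pA _ pU).
exists ([set h | act h^-1%g @` (act g @` U) = act g^-1%g @` (act g @` U)],
  stone_basic Delta U).
  split; first exact: near_image_act (generated_Galgebra_clopen AgU).
  by apply/stone_nbhsP; exists U; split.
move=> [h q] [/= hE qU]; apply: UN; exists U => //.
have gU : act g^-1%g @` (act g @` U) = U.
  by rewrite !image_act invgK; apply/seteqP; split=> x /=; rewrite act_inv.
rewrite gU in hE; rewrite -[in LHS]hE !image_act invgK.
by apply/seteqP; split=> x /=; rewrite act_invV.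
Qed.

HB.instance Definition _ Delta := @isFlow.Build G (stone_space Delta)
  (@stone_act Delta) (@stone_act1 Delta) (@stone_actM Delta)
  (@stone_act_continuous Delta) (@stone_compact Delta)
  (@stone_hausdorff Delta).

End stone_flow.
Arguments clopen_orbits {G} X.
Arguments stone_pi {G X} Delta x.

(* Main.v *)
Require Import Defs.
From HB Require Import structures.
From mathcomp Require Import all_boot all_order all_algebra.
From mathcomp Require Import finmap.
From mathcomp Require Import all_classical all_reals all_analysis.

Set Implicit Arguments.
Unset Strict Implicit.
Unset Printing Implicit Defensive.

Local Open Scope classical_set_scope.

(** Write [stone_pi Delta x] for the image of [x] in the Stone space of the
    algebra generated by the finite set of orbits [Delta].  Choose a finite set
    [Sigma] of representatives of these orbits, so that the sets
    [act a @` U], [a] in [G] and [U] in [Sigma], generate the algebra as a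
    Boolean algebra.  A map [eta] of the Stone space to itself gives a 0-1
    matrix, with rows indexed by [a] in [G] and columns by pairs [(y, U)] in
    [S `*` Sigma], whose entry says whether [act a @` U] belongs to the
    ultrafilter [eta (stone_pi Delta y)]; its rows are the sets
    [trace S Sigma eta a].  When [eta] is the translation by [h^-1], the entry
    says whether [y] is in [act (h * a) @` U], so the restriction of the matrix
    to finitely many columns [(y i, U i)] has as its row [a] the colour
    [c (h * a)] of a definable [Sigma]-coloring [c].  Since a neighbourhood of
    [eta] for pointwise convergence controls finitely many entries, every [eta]
    in the Ellis semigroup agrees with a translation on any finite submatrix.

    If the image of [S] under such an [eta] is finite, the row [a] is
    determined by the set of those pairs [(q, U)] of a point of this finite
    image and an element of [Sigma] for which [act a @` U] is in [q].  The
    number of such sets bounds the number of colours, for all colorings at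
    once ([DRdeg_of_finite_ellis]).

    Conversely, if [l] bounds the Ramsey degree, for every finite submatrix
    some translation has at most [l] distinct rows there
    ([few_rows_translation]).  Compactness of the space of self-maps yields one
    [eta] in the Ellis semigroup with this property for all finite submatrices
    simultaneously ([exists_ellis_few_rows]).  Then the whole matrix has
    finitely many distinct rows ([finite_rows]), hence finitely many distinct
    columns ([finite_columns]); as an ultrafilter is determined by its values
    on the generators ([stone_ext]), there are finitely many points
    [eta (stone_pi Delta y)] with [y] in [S] ([finite_ellis_of_DRdeg]). *)

(** * Finite sets and 0-1 matrices *)

Lemma finite_powerset (T : Type) (D : set T) :
  finite_set D -> finite_set [set E : set T | E `<=` D].
Proof.
elim/Pchoice: T => T in D *; move=> /finite_fsetP[X ->].
apply: sub_finite_set (finite_image (fun Y : {fset T} => [set` Y])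
  (finite_fset (fpowerset X))) => E EX.
have fE : finite_set E := sub_finite_set EX (finite_fset X).
exists (fset_set E) => /=; last exact: fset_setK.
rewrite fpowersetE; apply/fsubsetP => x.
by rewrite in_fset_set// => /set_mem/EX.
Qed.

(** On [A], the map [g] factors through [f]. *)
Lemma finite_factor (T U V : Type) (A : set T) (f : T -> U) (g : T -> V) :
  (forall x y, A x -> A y -> f x = f y -> g x = g y) ->
  finite_set (f @` A) -> finite_set (g @` A).
Proof.
elim/Pchoice: T => T in A f g *.
move=> fg fA; have [->|/set0P[x0 Ax0]] := eqVneq A set0.
  by rewrite image_set0.
pose h u := g (xget x0 [set x | A x /\ f x = u]).
apply: sub_finite_set (finite_image h fA) => _ [x Ax <-].
exists (f x); first by exists x.
rewrite /h; case: xgetP => [y -> [Ay fyx]|/(_ x)[]//].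
exact: fg.
Qed.

(** A matrix is a map [M] sending a row index to the set of columns where that
    row has a 1.  If there were [l.+1] distinct rows, finitely many columns
    would suffice to tell them apart, giving a finite submatrix with more than
    [l] distinct rows. *)
Lemma finite_rows (I J : Type) (M : I -> set J) (l : nat) :
  (forall (A : set I) (C : set J), finite_set A -> finite_set C ->
    ([set M a `&` C | a in A] #<= `I_l)%card) ->
  finite_set (range M).
Proof.
elim/Pchoice: I => I in M *.
move=> Ml; apply: contrapT => infM.
have [_ [i0 _ _]] := infinite_setN0 infM.
have [B BM lB] := infinite_set_fset l.+1 infM.
(* [D p] holds a column where the two rows of [p] differ, if there is one; a set
   of columns rather than a column, since [J] may be empty. *)
have /choice[D DP] (p : set J * set J) : exists C : set J, finite_set C /\
    (p.1 `&` C = p.2 `&` C -> p.1 = p.2).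
  have [->|/eqP p12] := eqVneq p.1 p.2; first by exists set0.
  have /existsNP[j pj] : ~ forall j, p.1 j = p.2 j.
    by move=> /funext.
  exists [set j]; split=> // /(congr1 (@^~ j)) /= pE.
  case: pj; move: pE; rewrite !propeqE => -[p1 p2].
  by split=> pj; [case: p1|case: p2].
pose C := \bigcup_(p in [set` B] `*` [set` B]) D p.
have fC : finite_set C.
  by apply: bigcup_finite => [|p _]; [exact: finite_setX|case: (DP p)].
pose A := (fun R => xget i0 [set i | M i = R]) @` [set` B].
have MA : [set R `&` C | R in [set` B]] `<=` [set M a `&` C | a in A].
  move=> _ [R BR <-]; exists (xget i0 [set i | M i = R]); first by exists R.
  case: xgetP => [y -> ->//|]; have [i _ <-] := BM _ BR.
  by move=> /(_ i)[].
have Cinj : {in [set` B] &, injective (fun R : set J => R `&` C)}.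
  move=> R R' /set_mem BR /set_mem BR' RR'; apply: (DP (R, R')).2 => /=.
  have DC : D (R, R') `<=` C by move=> j Dj; exists (R, R').
  by rewrite -(setIidr DC) !setIA RR'.
have fA : finite_set A by exact: finite_image.
have := card_le_trans (subset_card_le MA) (Ml A C fA fC).
rewrite (card_le_eql (inj_card_eq Cinj)).
have /card_eq_fsetP/card_le_eql -> : #|` B| = #|` B| by [].
by rewrite card_le_II leqNgt lB.
Qed.

(** A column is determined by the set of those rows that contain it. *)
Lemma finite_columns (I J : Type) (M : I -> set J) :
  finite_set (range M) -> finite_set (range (fun j => [set i | M i j])).
Proof.
move=> /finite_powerset/(finite_image (fun Q => M @^-1` Q)).
apply: sub_finite_set => _ [j _ <-].
exists [set R | range M R /\ R j] => [R []//|].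
by apply/seteqP; split=> i /= => [[]|] // Mij; split=> //; exists i.
Qed.


(** * Points of the Stone space *)

Section stone.
Context {G : topGroupType} {X : flowType G}.
Implicit Types (Delta : set (clopen_orbits X)) (U V : set X) (a h : G).

Lemma image_actM a h V : act a @` (act h @` V) = act (a * h)%g @` V.
Proof.
by rewrite image_comp; congr image; apply/funext => x /=; rewrite actM.
Qed.

Lemma image_act1 V : act 1%g @` V = V.
Proof.
by rewrite (_ : act 1%g = id) ?image_id//; apply/funext => x; rewrite act1.
Qed.

Lemma stone_valC Delta (q : stone_space Delta) V :
  generated_Galgebra Delta V -> stone_val q (~` V) <-> ~ stone_val q V.
Proof.
move=> AV; have [_ [_ q0] qI _ qU] := stone_valP q; split=> [qCV qV|nqV].
  by apply: q0; rewrite -(setICr V); exact: qI.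
by have [/nqV|] := qU _ AV.
Qed.

Lemma stone_valI Delta (q : stone_space Delta) U V :
  generated_Galgebra Delta U -> generated_Galgebra Delta V ->
  stone_val q (U `&` V) <-> stone_val q U /\ stone_val q V.
Proof.
move=> AU AV; have [_ _ qI qS _] := stone_valP q.
split=> [qUV|[]]; last exact: qI.
by split; apply: (qS _ _ qUV) => // x [].
Qed.

(** The sets whose translates all lie in both of [p] and [q] or in neither form
    a Boolean G-algebra.  Quantifying over the translates is what makes this
    family invariant under the action. *)
Lemma stone_ext Delta (Gen : set (set X)) (p q : stone_space Delta) :
  Gen `<=` generated_Galgebra Delta ->
  \bigcup_(O in Delta) set_val O `<=` \bigcup_(U in Gen) translates U ->
  (forall a U, Gen U ->
    stone_val p (act a @` U) <-> stone_val q (act a @` U)) ->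
  p = q.
Proof.
move=> GenA DeltaGen pq; have [AT AI AC AG] := generated_GalgebraP Delta.
pose E := [set V | generated_Galgebra Delta V /\
  forall a, stone_val p (act a @` V) <-> stone_val q (act a @` V)].
have EG : boolean_Galgebra E.
  split.
  - split=> // a; rewrite image_act preimage_setT.
    by split=> _; [have [_ []] := stone_valP q|have [_ []] := stone_valP p].
  - move=> U V [AU EU] [AV EV]; split=> [|a]; first exact: AI.
    rewrite image_act preimage_setI -!image_act !stone_valI; try exact: AG.
    by rewrite EU EV.
  - move=> V [AV EV]; split=> [|a]; first exact: AC.
    rewrite image_act -preimage_setC -!image_act !stone_valC; try exact: AG.
    by rewrite EV.
  - move=> b V [AV EV]; split=> [|a]; first exact: AG.
    by rewrite image_actM.
have AE : generated_Galgebra Delta `<=` E.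
  apply: smallest_sub => // V /DeltaGen[U GU [b _ <-]].
  by split=> [|a]; [apply: AG; exact: GenA|rewrite image_actM; exact: pq].
have [pA _ _ _ _] := stone_valP p.
apply: stone_eqP => V pV; have [_ /(_ 1%g)] := AE _ (pA _ pV).
by rewrite image_act1 => -[+ _]; apply.
Qed.

Lemma stone_val_act_pi Delta h x V : generated_Galgebra Delta V ->
  stone_val (act h (stone_pi Delta x)) V <-> (act h^-1%g @` V) x.
Proof.
move=> AV; have [_ _ _ AG] := generated_GalgebraP Delta.
split=> [[W [AW Wx] <-]|Vx].
  by rewrite image_act invgK /=; exists x.
exists (act h^-1%g @` V); first by split=> //; exact: AG.
by rewrite !image_act invgK; apply/seteqP; split=> y /=; rewrite act_invV.
Qed.

(** Pointwise convergence controls finitely many conditions of the form: the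
    clopen set [V] belongs to the ultrafilter [f q]. *)
Lemma ptws_near_stone_val Delta
    (eta : {ptws stone_space Delta -> stone_space Delta})
    (D : set (stone_space Delta * set X)) :
  finite_set D -> (forall d, D d -> generated_Galgebra Delta d.2) ->
  \forall f \near eta, forall d, D d ->
    stone_val (f d.1) d.2 <-> stone_val (eta d.1) d.2.
Proof.
move=> /finite_fsetP[{}D ->] DA.
have [_ _ AC _] := generated_GalgebraP Delta.
have etaF : Filter (nbhs eta) by exact: nbhs_filter.
pose agree d := [set f : {ptws stone_space Delta -> stone_space Delta} |
  stone_val (f d.1) d.2 <-> stone_val (eta d.1) d.2].
apply: filterS (@filter_bigI _ _ D agree (nbhs eta) _ _).
  by move=> f.
move=> d /= dD; have Ad := DA _ dD.
(* Both truth values of a condition are open: its negation says that [f d.1]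
   contains the complement of [d.2]. *)
have near_eval V : stone_val (eta d.1) V ->
    \forall f \near eta, stone_val (f d.1) V.
  move=> etaV; have nV : nbhs (eta d.1) (stone_basic V).
    by apply/stone_nbhsP; exists V; split.
  exact: (@proj_continuous _ (fun=> stone_space Delta) d.1 eta _ nV).
have [etad|netad] := lem (stone_val (eta d.1) d.2).
  by apply: filterS (near_eval _ etad) => f fd; split.
have /near_eval : stone_val (eta d.1) (~` d.2) by apply/stone_valC.
by apply: filterS => f /stone_valC - /(_ Ad) nfd; split.
Qed.
(** * From a finite image to a Ramsey degree *)

(** The bound [l] is the number of subsets of the product [D] of the finite
    image of [S] by [Sigma]: near [eta] there is a translation by some [g], and
    for [h] equal to [g^-1] the colour of [h * a] depends only on the set of
    those [(q, U)] in [D] with [act a @` U] in [q]. *)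
Lemma DRdeg_of_finite_ellis (S : set X) :
  (forall Delta, finite_set Delta ->
    exists2 eta : stone_space Delta -> stone_space Delta,
      ellis (stone_space Delta) eta &
      finite_set (eta @` (stone_pi Delta @` S))) ->
  sep_fin_DRdeg S.
Proof.
move=> ellisS Sigma finSigma clSigma.
pose Delta : set (clopen_orbits X) :=
  set_val @^-1` [set translates U | U in Sigma].
have finDelta : finite_set Delta.
  apply: finite_preimage; last exact: finite_image.
  by move=> O O' _ _; exact: val_inj.
have gen_translate U a : Sigma U -> generated_Galgebra Delta (act a @` U).
  move=> SU; have UO : clopen_orbits X (translates U).
    by exists U => //; exact: clSigma.
  apply: sub_gen_smallest; exists (SigSub (mem_set UO)); first by exists U.
  by exists a.
have [eta eta_ellis eta_fin] := ellisS Delta finDelta.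
pose D := (eta @` (stone_pi Delta @` S)) `*` Sigma.
have /finite_set_leP[l Dl] : finite_set [set E | E `<=` D].
  by apply: finite_powerset; exact: finite_setX.
(* The successor serves to have a bound that is visibly positive. *)
exists l.+1 => // n c _ [U [y [Sigma_U Sy cE]]] k A _ Ak.
have finA : finite_set A by exists k.
pose W :=
  [set (stone_pi Delta (y i), act a @` U i) | i in [set: 'I_n] & a in A].
have finW : finite_set W by exact: finite_image2.
have genW d : W d -> generated_Galgebra Delta d.2.
  by move=> [i _ [a _ <-]]; exact: gen_translate.
have /eta_ellis[_ [[g _ <-] etag]] := ptws_near_stone_val eta finW genW.
have yP i a : A a -> (act (g^-1 * a)%g @` U i) (y i) <->
    stone_val (eta (stone_pi Delta (y i))) (act a @` U i).
  move=> Aa; rewrite -image_actM.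
  rewrite -(stone_val_act_pi g (y i) (gen_translate _ a (Sigma_U i))).
  by apply: (etag (_, _)); exists i => //; exists a.
exists g^-1%g.
pose color E : {ffun 'I_n -> bool} :=
  [ffun i => `[< E (eta (stone_pi Delta (y i)), U i) >]].
suff sub : c @` [set (g^-1 * a)%g | a in A] `<=` color @` [set E | E `<=` D].
  apply: card_le_trans (subset_card_le sub) _.
  apply: card_le_trans (card_image_le _ _) _.
  by apply: card_le_trans Dl _; rewrite card_le_II.
move=> _ [_ [a Aa <-] <-].
exists [set d | D d /\ stone_val d.1 (act a @` d.2)] => [d []//|].
apply/ffunP => i; rewrite ffunE cE; apply/asboolP/idP => /=.
  by move=> [_ /(yP _ _ Aa)]; rewrite inE.
rewrite inE => /(yP _ _ Aa) etay; split=> //.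
split=> //=; exists (stone_pi Delta (y i)) => //.
by exists (y i).
Qed.

(** * From a Ramsey degree to a finite image *)

(** The row of index [a] of the matrix attached to [f]. *)
Definition trace Delta (S : set X) (Sigma : set (set X))
    (f : stone_space Delta -> stone_space Delta) a : set (X * set X) :=
  [set d | [/\ S d.1, Sigma d.2 &
    stone_val (f (stone_pi Delta d.1)) (act a @` d.2)]].

Definition few_rows Delta (S : set X) (Sigma : set (set X)) (l : nat)
    (C : set (X * set X)) (A : set G)
    (f : stone_space Delta -> stone_space Delta) :=
  ([set trace S Sigma f a `&` C | a in A] #<= `I_l)%card.

Section compactness.
Context {S : set X} {Sigma : set (set X)} {Delta : set (clopen_orbits X)}.
Context {l : nat}
  (l_gt0 : (1 <= l)%N)
  (l_bound : forall (n : nat) (c : G -> {ffun 'I_n -> bool}),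
    (1 <= n)%N -> definable_coloring S Sigma c ->
    forall (k : nat) (A : set G), (1 <= k)%N -> (A #= `I_k)%card ->
    exists h : G, (c @` [set (h * a)%g | a in A] #<= `I_l)%card)
  (gen_translate :
    forall a U, Sigma U -> generated_Galgebra Delta (act a @` U)).

(** On finitely many columns [(y i, U i)], the rows of the translation by
    [h^-1] correspond to the colours of the coloring defined by the [y i] and
    the [U i]. *)
Lemma few_rows_translation C A : finite_set C -> finite_set A ->
  exists h, few_rows S Sigma l C A (act h : stone_space Delta -> _).
Proof.
move=> finC [k Ak]; pose C' := C `&` (S `*` Sigma).
have finC' : finite_set C' by exact: finite_setIl.
have traceC f a : trace S Sigma f a `&` C = trace S Sigma f a `&` C'.
  by apply/seteqP; split=> d [[? ? ?]]; [|move=> []].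
(* The bound concerns colorings with [n >= 1] and sets with [k >= 1] elements,
   which excludes submatrices without columns or without rows. *)
have [C0|C0] := eqVneq C' set0.
  exists 1%g; apply: (@card_le_trans _ _ _ [set (set0 : set (X * set X))]).
    by apply: subset_card_le => _ [a Aa <-]; rewrite traceC C0 setI0.
  by rewrite (card_le_eql card_set1) card_le_II.
case: k Ak => [|k] Ak.
  exists 1%g; move: Ak; rewrite II0 card_eq0 => /eqP ->.
  by rewrite /few_rows image_set0; exact: card_ge0.
have /finite_seqP[s C's] := finC'.
pose e (i : 'I_(size s)) := tnth (in_tuple s) i.
have eC' i : C' (e i) by rewrite C's; exact: mem_tnth.
have C'e d : C' d -> exists i, e i = d.
  by rewrite C's => /= /seq_tnthP[i ->]; exists i.
have s_gt0 : (1 <= size s)%N.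
  by have /set0P[d /C'e[i _]] := C0; exact: leq_trans (ltn_ord i).
pose c g : {ffun 'I_(size s) -> bool} :=
  [ffun i => (e i).1 \in act g @` (e i).2].
have defc : definable_coloring S Sigma c.
  exists (fun i => (e i).2), (fun i => (e i).1).
  by split=> [i|i|g i]; rewrite ?ffunE //; case: (eC' i) => _ [].
have [h hl] := l_bound s_gt0 defc (ltn0Sn _) Ak.
exists h^-1%g; apply: card_le_trans hl.
pose row (b : {ffun 'I_(size s) -> bool}) := [set e i | i in [set i | b i]].
apply: card_le_trans (card_image_le row _); apply: subset_card_le.
move=> _ [a Aa <-]; exists (c (h * a)%g).
  by exists (h * a)%g => //; exists a.
rewrite traceC; apply/seteqP; split=> [_ [i /= ci <-]|d [[Sd Sigd fd] C'd]].
  have [_ [Sd Sigd]] := eC' i; split => //; split=> //.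
  rewrite stone_val_act_pi ?invgK; last exact: gen_translate.
  by move: ci; rewrite ffunE inE image_actM.
have [i eid] := C'e _ C'd; exists i => //=; rewrite ffunE eid inE.
move: fd; rewrite stone_val_act_pi ?invgK ?image_actM//.
exact: gen_translate.
Qed.

Lemma few_rows_subset C C' A A' (f : stone_space Delta -> stone_space Delta) :
  C `<=` C' -> A `<=` A' ->
  few_rows S Sigma l C' A' f -> few_rows S Sigma l C A f.
Proof.
move=> CC' AA'; apply: card_le_trans.
apply: card_le_trans (card_image_le (setI^~ C) _).
apply: subset_card_le => _ [a Aa <-].
exists (trace S Sigma f a `&` C'); first by exists a => //; exact: AA'.
by rewrite -setIA (setIidr CC').
Qed.

(** Having few rows on a finite submatrix is a closed condition. *)
Lemma few_rows_near (eta : {ptws stone_space Delta -> stone_space Delta}) C A :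
  finite_set C -> finite_set A ->
  \forall f \near eta, few_rows S Sigma l C A f -> few_rows S Sigma l C A eta.
Proof.
move=> finC finA.
pose W := [set (stone_pi Delta d.1, act a @` d.2) |
  d in C `&` (S `*` Sigma) & a in A].
have finW : finite_set W by apply: finite_image2 => //; exact: finite_setIl.
have genW d : W d -> generated_Galgebra Delta d.2.
  by move=> [u [_ [_ Su]] [a _ <-]]; exact: gen_translate.
have etaF : Filter (nbhs eta) by exact: nbhs_filter.
apply: filterS (ptws_near_stone_val eta finW genW) => f fW.
suff traceE a : A a -> trace S Sigma f a `&` C = trace S Sigma eta a `&` C.
  rewrite /few_rows; congr (is_true (_ #<= _)%card).
  by apply: eq_imagel.
move=> Aa; apply/seteqP; split=> d [[Sd Sigd fd] Cd]; split=> //; split=> //;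
  apply/(fW (stone_pi Delta d.1, act a @` d.2)) => //;
  by exists d => //; exists a.
Qed.

(** The translations with few rows on a given finite submatrix form a filter
    base, because a larger submatrix imposes a stronger condition.  By
    Tychonoff's theorem it has a cluster point [eta], which is in the closure of
    the translations and inherits every one of the closed conditions. *)
Lemma exists_ellis_few_rows :
  exists2 eta, ellis (stone_space Delta) eta &
    forall C A, finite_set C -> finite_set A -> few_rows S Sigma l C A eta.
Proof.
pose Y := {ptws stone_space Delta -> stone_space Delta}.
pose ind : set (set (X * set X) * set G) :=
  [set CA | finite_set CA.1 /\ finite_set CA.2].
pose B CA : set Y := [set f | range act f /\ few_rows S Sigma l CA.1 CA.2 f].
pose F := filter_from ind B.
have FF : ProperFilter F.
  apply: filter_from_proper; last first.
    move=> [C A] [/= fC fA]; have [h hP] := few_rows_translation fC fA.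
    by exists (act h); split=> //; exists h.
  apply: filter_from_filter; first by exists (set0, set0); split.
  move=> [C A] [C' A'] [/= fC fA] [/= fC' fA'].
  exists (C `|` C', A `|` A'); first by split; rewrite /= finite_setU.
  by move=> f [rf /= fr]; split; split=> //=; apply: few_rows_subset fr.
have [eta [_ etaF]] : exists eta : Y,
    [set f : Y | forall i, setT (f i)] eta /\ cluster F eta.
  apply: (@tychonoff _ (fun=> stone_space Delta) (fun=> setT)).
    by move=> _; exact: flow_compact.
  exact: filterS filterT.
exists eta.
  move=> N Neta; have [|f [[rf _] Nf]] := etaF (B (set0, set0)) N _ Neta.
    by exists (set0, set0) => //; split.
  by exists f.
move=> C A fC fA; have fB : F (B (C, A)) by exists (C, A).
have [f [[_ Bf] Nf]] := etaF _ _ fB (few_rows_near eta fC fA).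
exact: Nf.
Qed.

End compactness.

Lemma finite_ellis_of_DRdeg (S : set X) Delta :
  sep_fin_DRdeg S -> finite_set Delta ->
  exists2 eta : stone_space Delta -> stone_space Delta,
    ellis (stone_space Delta) eta &
    finite_set (eta @` (stone_pi Delta @` S)).
Proof.
move=> DRdegS finDelta.
have /choice[rep repP] (O : clopen_orbits X) :
    exists U, clopen U /\ translates U = set_val O.
  by have [U] := set_valP O; exists U.
pose Sigma := rep @` Delta.
have clSigma : Sigma `<=` clopen by move=> _ [W _ <-]; case: (repP W).
have gen_translate a U : Sigma U -> generated_Galgebra Delta (act a @` U).
  move=> [W DW <-]; apply: sub_gen_smallest; exists W => //.
  by have [_ <-] := repP W; exists a.
have Sigma_gen : Sigma `<=` generated_Galgebra Delta.
  by move=> U SU; rewrite -(image_act1 U); exact: gen_translate.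
have DeltaSigma :
    \bigcup_(O in Delta) set_val O `<=` \bigcup_(U in Sigma) translates U.
  move=> V [W DW WV]; exists (rep W); first by exists W.
  by have [_ ->] := repP W.
have [l l_gt0 l_bound] := DRdegS Sigma (finite_image _ finDelta) clSigma.
have [eta eta_ellis eta_rows] :=
  exists_ellis_few_rows l_gt0 l_bound gen_translate.
exists eta => //; rewrite image_comp.
have fin_trace : finite_set (range (trace S Sigma eta)).
  by apply: (@finite_rows _ _ _ l) => A C finA finC; exact: eta_rows.
(* Moving [U] from the column index to the row index makes the columns
   correspond to the points of [S]. *)
pose N (r : G * set X) : set X := [set x | trace S Sigma eta r.1 (x, r.2)].
have fin_N : finite_set (range N).
  pose slice (R : set (X * set X)) U : set X := [set x | R (x, U)].
  have fin_slices : finite_set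
      [set slice R U | R in range (trace S Sigma eta) & U in Sigma].
    by apply: finite_image2 => //; exact: finite_image.
  apply: (@sub_finite_set _ _ (set0 |` _)); last first.
    by rewrite finite_setU; split; [exact: finite_set1|exact: fin_slices].
  move=> _ [[a U] _ <-]; have [SU|nSU] := lem (Sigma U); [right|left].
    by exists (trace S Sigma eta a); [exists a|exists U].
  by apply/seteqP; split=> x // [_ /nSU].
apply: (finite_factor (f := fun x => [set r | N r x])); last first.
  apply: sub_finite_set (finite_columns fin_N) => _ [x _ <-].
  by exists x.
move=> x y Sx Sy xy; apply: (stone_ext Sigma_gen DeltaSigma) => a U SU.
have := congr1 (@^~ (a, U)) xy; rewrite /N /trace /= propeqE => -[xy1 yx1].
by split=> [xU|yU]; [case: xy1|case: yx1].
Qed.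

End stone.

Theorem theorem3p17 (G : topGroupType) (X : flowType G) (x0 : X)
    (ambitX : ambit x0) (dim0X : has_clopen_basis X) (S : set X) :
  sep_fin_DRdeg S <->
  forall Delta : set (clopen_orbits X), finite_set Delta ->
    exists2 eta : stone_space Delta -> stone_space Delta,
      ellis (stone_space Delta) eta &
      finite_set (eta @` (stone_pi Delta @` S)).
Proof.
split=> [DRdegS Delta|]; last exact: DRdeg_of_finite_ellis.
exact: finite_ellis_of_DRdeg.
Qed.
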